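(* Let $A$ be an integral domain and $E$ an $A$-module. If $A$ is a field, then the idealization $A(+)E$ is a quasi second ring. The converse holds if $E$ is a factorial $A$-module: if $E$ is factorial and $A(+)E$ is a quasi second ring, then $A$ is a field.
   Context: The idealization $A(+)E=\{(a,m): a\in A, m\in E\}$ is the commutative ring with componentwise addition and multiplication $(a_1,m_1)(a_2,m_2)=(a_1a_2,a_1m_2+a_2m_1)$. A commutative ring $R$ with unity is a quasi second ring if for all $a,b\in R$, $0\neq bR\subseteq aR\neq R$ implies $bR=aR$. An element $m\in E$ is irreducible in $E$ if it has no proper factor, i.e. $m=am'$ with $a\in A$, $m'\in E$ implies $a$ is a unit. A torsion free $A$-module $E$ is factorial if every nonzero $m\in E$ has an irreducible factorization $m=a_1\cdots a_n m'$ ($a_i$ irreducible in $A$, $m'$ irreducible in $E$), unique up to order and associates. *)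

(* Defs.v *)
From HB Require Import structures.
From mathcomp Require Import all_boot all_algebra.
From mathcomp Require Import classical_sets.

Set Implicit Arguments.
Unset Strict Implicit.
Unset Printing Implicit Defensive.

Import GRing.Theory.

Local Open Scope classical_set_scope.
Local Open Scope ring_scope.

(* An alias of the product type, so that the ring structure below does not
   compete with the componentwise product of rings. *)
Definition idealization (A : comNzRingType) (E : lmodType A) : Type :=
  (A * E)%type.

HB.instance Definition _ (A : comNzRingType) (E : lmodType A) :=
  GRing.Zmodule.on (idealization E).

Definition idealization_one (A : comNzRingType) (E : lmodType A) :
  idealization E := (1, 0).

Definition idealization_mul (A : comNzRingType) (E : lmodType A)
    (x y : idealization E) : idealization E :=
  (x.1 * y.1, x.1 *: y.2 + y.1 *: x.2).

Fact idealization_mulA (A : comNzRingType) (E : lmodType A) :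
  associative (@idealization_mul A E).
Proof.
move=> [a m] [b n] [c p]; congr pair; rewrite /= ?mulrA //.
by rewrite !scalerDr !scalerA addrA (mulrC c a) (mulrC c b).
Qed.

Fact idealization_mulC (A : comNzRingType) (E : lmodType A) :
  commutative (@idealization_mul A E).
Proof. by move=> [a m] [b n]; congr pair; [exact: mulrC | exact: addrC]. Qed.

Fact idealization_mul1 (A : comNzRingType) (E : lmodType A) :
  left_id (@idealization_one A E) (@idealization_mul A E).
Proof.
move=> [a m]; congr pair; first exact: mul1r.
by rewrite /= scale1r scaler0 addr0.
Qed.

Fact idealization_mulDl (A : comNzRingType) (E : lmodType A) :
  left_distributive (@idealization_mul A E) +%R.
Proof.
move=> [a m] [b n] [c p]; congr pair; first exact: mulrDl.
by rewrite /= scalerDl scalerDr addrACA.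
Qed.

Fact idealization_one_neq0 (A : comNzRingType) (E : lmodType A) :
  idealization_one E != 0.
Proof. by apply/eqP => -[/eqP]; rewrite oner_eq0. Qed.

HB.instance Definition _ (A : comNzRingType) (E : lmodType A) :=
  GRing.Zmodule_isComNzRing.Build (idealization E)
    (@idealization_mulA A E) (@idealization_mulC A E) (@idealization_mul1 A E)
    (@idealization_mulDl A E) (@idealization_one_neq0 A E).

Definition principal_ideal (R : comPzRingType) (a : R) : set R :=
  [set x | exists r : R, x = a * r].

Definition quasi_second_ring (R : comPzRingType) : Prop :=
  forall a b : R,
    principal_ideal b <> [set 0] ->
    principal_ideal b `<=` principal_ideal a ->
    principal_ideal a <> setT ->
    principal_ideal b = principal_ideal a.

Definition irreducible_elt (A : idomainType) (a : A) : Prop :=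
  [/\ a != 0, a \isn't a GRing.unit &
      forall b c : A, a = b * c -> b \is a GRing.unit \/ c \is a GRing.unit].

Definition irreducible_in (A : idomainType) (E : lmodType A) (m : E) : Prop :=
  forall (a : A) (m' : E), m = a *: m' -> a \is a GRing.unit.

Definition torsion_free (A : idomainType) (E : lmodType A) : Prop :=
  forall (a : A) (m : E), a *: m = 0 -> a = 0 \/ m = 0.

Definition associates (A : idomainType) (a b : A) : Prop :=
  exists2 u : A, u \is a GRing.unit & a = u * b.

Definition associates_in (A : idomainType) (E : lmodType A) (m n : E) : Prop :=
  exists2 u : A, u \is a GRing.unit & m = u *: n.

(* The list s of ring factors may be empty: m is then itself irreducible. *)
Definition irreducible_factorization (A : idomainType) (E : lmodType A)
    (m : E) (s : seq A) (m' : E) : Prop :=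
  [/\ forall a, a \in s -> irreducible_elt a,
      irreducible_in m' &
      m = (\prod_(a <- s) a) *: m'].

Definition associates_up_to_order (A : idomainType) (s t : seq A) : Prop :=
  exists t' : seq A,
    [/\ perm_eq t t', size s = size t' &
        forall i, (i < size s)%N -> associates s`_i t'`_i].

Definition factorial_module (A : idomainType) (E : lmodType A) : Prop :=
  torsion_free E /\
  forall m : E, m != 0 ->
    (exists s m', irreducible_factorization m s m') /\
    (forall s m' t n', irreducible_factorization m s m' ->
       irreducible_factorization m t n' ->
       associates_up_to_order s t /\ associates_in m' n').

(* Main.v *)
Require Import Defs.
From mathcomp Require Import all_boot all_algebra.
From mathcomp Require Import classical_sets.

(** Over a field [A], every element of the idealization with a nonzero first
    component is invertible, so a generator of a proper principal ideal has the
    form [(0, m)]. The ideal of [(0, m)] consists of the [(0, y *: m)], and each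
    nonzero one of these generates the same ideal, since [y] can be inverted:
    this is [field_quasi_second].

    Conversely, [A] embeds in the idealization as the elements [(a, 0)], and
    the first projection is a ring morphism that splits this embedding.
    If [a] is neither zero nor a unit, then the ideal of [(a, 0)] is proper,
    and it contains the nonzero ideal of [(a ^+ 2, 0)]. If the two ideals were
    equal, projecting would give [a = a ^+ 2 * r], and cancelling [a] in the
    domain would make [a] a unit: this is [quasi_second_field]. *)

Set Implicit Arguments.
Unset Strict Implicit.
Unset Printing Implicit Defensive.

Import GRing.Theory.

Local Open Scope classical_set_scope.
Local Open Scope ring_scope.

Section PrincipalIdeal.
Variable R : comPzRingType.
Implicit Types a b : R.

Lemma principal_ideal_id a : principal_ideal a a.
Proof. by exists 1; rewrite mulr1. Qed.

Lemma principal_ideal_subset a b :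
  principal_ideal b `<=` principal_ideal a <-> principal_ideal a b.
Proof.
split=> [sba|[r ->] _ [s ->]]; first exact/sba/principal_ideal_id.
by exists (r * s); rewrite mulrA.
Qed.

Lemma principal_ideal_full a :
  principal_ideal a = setT <-> exists r, a * r = 1.
Proof.
split=> [aT|[r ar1]].
  have [r ->] : principal_ideal a 1 by rewrite aT.
  by exists r.
apply/seteqP; split=> // x _.
by exists (r * x); rewrite mulrA ar1 mul1r.
Qed.

Lemma principal_ideal_zero a : principal_ideal a = [set 0] <-> a = 0.
Proof.
split=> [a0|->].
  by have := principal_ideal_id a; rewrite a0.
apply/seteqP; split=> [_ [r ->]|_ ->]; first by rewrite /= mul0r.
exact: principal_ideal_id.
Qed.

End PrincipalIdeal.

Section Idealization.
Variables (A : idomainType) (E : lmodType A).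
Implicit Types (a b : A) (m n : E) (x y : idealization E).

(* The cast selects the idealization product over the componentwise one. *)
Local Notation "''[' a , m ]" := ((a, m) : idealization E)
  (at level 0, format "''[' a ,  m ]").

Lemma idealizationM a b m n :
  '[a, m] * '[b, n] = '[a * b, a *: n + b *: m].
Proof. by []. Qed.

Lemma fst_idealizationM x y : (x * y).1 = x.1 * y.1.
Proof. by []. Qed.

(** Every [(0, m)] squares to zero, so [(a, m)], a unit plus a nilpotent
    element, is inverted by a geometric series that stops after two terms. *)
Lemma idealization_inv a m : a \is a GRing.unit ->
  '[a, m] * '[a^-1, - (a^-1 * a^-1) *: m] = 1.
Proof.
move=> ua; rewrite idealizationM divrr // scalerA mulrN mulrA divrr // mul1r.
by rewrite scaleNr addNr.
Qed.

Lemma field_quasi_second :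
  GRing.field_axiom A -> quasi_second_ring (idealization E).
Proof.
move=> fA [a m] b b0 /principal_ideal_subset ab aT.
have a0 : a = 0.
  apply/eqP/negPn/negP => /fA ua; apply: aT.
  by apply/principal_ideal_full; eexists; exact: idealization_inv.
apply/seteqP; split; apply/principal_ideal_subset=> //.
move: ab b0; rewrite a0 => -[[y p] ->].
rewrite idealizationM mul0r scale0r add0r => b0.
have uy : y \is a GRing.unit.
  apply: fA; apply/eqP => y0; apply: b0.
  by apply/principal_ideal_zero; rewrite y0 scale0r.
exists (y^-1, 0).
by rewrite idealizationM mul0r scale0r add0r scalerA mulVr // scale1r.
Qed.

Lemma quasi_second_field :
  quasi_second_ring (idealization E) -> GRing.field_axiom A.
Proof.
move=> qs a a0; apply/negPn/negP => /negP nua.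
have unit_of_eq1 r : a * r = 1 -> False.
  by move=> ar1; apply: nua; apply/unitrPr; exists r.
pose ia : idealization E := (a, 0).
have eq_ideal : principal_ideal (ia * ia) = principal_ideal ia.
  apply: qs => [/principal_ideal_zero/(congr1 fst)/eqP||].
  - by rewrite fst_idealizationM /= mulf_eq0 orbb (negPf a0).
  - by apply/principal_ideal_subset; exists ia.
  - case/principal_ideal_full => r /(congr1 fst).
    by rewrite fst_idealizationM => /unit_of_eq1.
have [r] : principal_ideal (ia * ia) ia.
  by rewrite eq_ideal; exact: principal_ideal_id.
move=> /(congr1 fst); rewrite !fst_idealizationM /= -mulrA => aE.
by apply: (unit_of_eq1 r.1); apply: (mulfI a0); rewrite mulr1 -aE.
Qed.

End Idealization.

Theorem theorem12 (A : idomainType) (E : lmodType A) :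
  (GRing.field_axiom A -> quasi_second_ring (idealization E)) /\
  (factorial_module E -> quasi_second_ring (idealization E) ->
     GRing.field_axiom A).
Proof.
by split=> [|_]; [exact: field_quasi_second | exact: quasi_second_field].
Qed.
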